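(* Let $R$ be a ring and let $\mathcal{I}$ be the ideal generated by a set $\{f^k:M_k\to N_k\}_{k\in K}$ of homomorphisms of left $R$-modules. A homomorphism $\varphi:U\to V$ of left $R$-modules is in $\mathcal{I}$ if and only if it has a factorization $$U\longrightarrow M_{k_1}^{m_1}\oplus\cdots\oplus M_{k_t}^{m_t}\xrightarrow{\ (h_{ji})\ }N_{k_1}^{n_1}\times\cdots\times N_{k_t}^{n_t}\longrightarrow V$$ for some finite list of indices $k_1,\dots,k_t\in K$ and positive integers $m_1,\dots,m_t,n_1,\dots,n_t$, where $(h_{ji})$ is a block diagonal matrix of homomorphisms whose $r$-th diagonal block ($1\le r\le t$), of size $n_r\times m_r$, defines a map $M_{k_r}^{m_r}\to N_{k_r}^{n_r}$ and has every entry equal to either $f^{k_r}$ or $0$, and all of whose entries outside the diagonal blocks are $0$.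
   Context: $R$ is an arbitrary ring; modules are left $R$-modules. An ideal is an additive subfunctor of $\operatorname{Hom}_R$, i.e. a class $\mathcal{I}$ of $R$-homomorphisms such that for all modules $M,N$ the members of $\mathcal I$ from $M$ to $N$ form a subgroup of $\operatorname{Hom}_R(M,N)$, and $f\circ g\circ h\in\mathcal{I}$ whenever $g\in\mathcal{I}$ and $f,h$ are composable homomorphisms. The ideal generated by a set of homomorphisms is the smallest ideal containing that set. The list $k_1,\dots,k_t$ may be empty ($t=0$), the empty direct sum being the zero module. *)

(* Defs.v *)
From HB Require Import structures.
From mathcomp Require Import all_boot all_order all_algebra.

Set Implicit Arguments.
Unset Strict Implicit.
Unset Printing Implicit Defensive.

Import GRing.Theory.
Local Open Scope ring_scope.

(* The finite direct sum (= product) of a family of modules is the type of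
   dependent finite functions, with componentwise operations; MathComp only
   provides these instances for non-dependent finite functions. *)
Section DirectSumZmod.
Variables (I : finType) (A : I -> zmodType).
Notation sumA := {dffun forall i, A i}.

Definition dsum_zero : sumA := [ffun i => 0 : A i].
Definition dsum_opp (x : sumA) : sumA := [ffun i => - x i : A i].
Definition dsum_add (x y : sumA) : sumA := [ffun i => x i + y i : A i].

Fact dsum_addA : associative dsum_add.
Proof. by move=> x y z; apply/ffunP=> i; rewrite !ffunE addrA. Qed.
Fact dsum_addC : commutative dsum_add.
Proof. by move=> x y; apply/ffunP=> i; rewrite !ffunE addrC. Qed.
Fact dsum_add0 : left_id dsum_zero dsum_add.
Proof. by move=> x; apply/ffunP=> i; rewrite !ffunE add0r. Qed.
Fact dsum_addN : left_inverse dsum_zero dsum_opp dsum_add.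
Proof. by move=> x; apply/ffunP=> i; rewrite !ffunE addNr. Qed.

HB.instance Definition _ := GRing.isZmodule.Build sumA
  dsum_addA dsum_addC dsum_add0 dsum_addN.
End DirectSumZmod.

Section DirectSumLmod.
Variables (R : pzRingType) (I : finType) (A : I -> lmodType R).
Notation sumA := {dffun forall i, A i}.

Definition dsum_scale (c : R) (x : sumA) : sumA := [ffun i => c *: x i : A i].

Fact dsum_scaleA c d x : dsum_scale c (dsum_scale d x) = dsum_scale (c * d) x.
Proof. by apply/ffunP=> i; rewrite !ffunE scalerA. Qed.
Fact dsum_scale1 : left_id 1 dsum_scale.
Proof. by move=> x; apply/ffunP=> i; rewrite !ffunE scale1r. Qed.
Fact dsum_scaleDr : right_distributive dsum_scale +%R.
Proof. by move=> c x y; apply/ffunP=> i; rewrite !ffunE scalerDr. Qed.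
Fact dsum_scaleDl x : {morph dsum_scale^~ x : c d / c + d}.
Proof. by move=> c d; apply/ffunP=> i; rewrite !ffunE scalerDl. Qed.

HB.instance Definition _ := GRing.Zmodule_isLmodule.Build R sumA
  dsum_scaleA dsum_scale1 dsum_scaleDr dsum_scaleDl.
End DirectSumLmod.

(* powsum A m is A_1^(m_1) (+) ... (+) A_t^(m_t); the i-th coordinate of x in
   the r-th summand is x r i. *)
Definition powsum (R : pzRingType) (t : nat) (A : 'I_t -> lmodType R)
    (m : 'I_t -> nat) : lmodType R :=
  {dffun forall r : 'I_t, (A r ^ m r)%type}.

Section MatrixMap.
Variables (R : pzRingType) (t : nat) (A B : 'I_t -> lmodType R).
Variables m n : 'I_t -> nat.

(* Rows are indexed by pairs (s, j) with j < n s, columns by pairs (r, i) with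
   i < m r; the entry at row (s, j) and column (r, i) is h s j r i. *)
Definition hom_matrix : Type :=
  forall (s : 'I_t) (j : 'I_(n s)) (r : 'I_t) (i : 'I_(m r)), {linear A r -> B s}.

Definition matrix_map (h : hom_matrix) (x : powsum A m) : powsum B n :=
  [ffun s => [ffun j : 'I_(n s) => \sum_r \sum_i h s j r i (x r i)]
     : (B s ^ n s)%type].

Fact matrix_map_is_linear (h : hom_matrix) : linear (matrix_map h).
Proof.
move=> c x y; apply/ffunP=> s; rewrite !ffunE; apply/ffunP=> j; rewrite !ffunE.
rewrite scaler_sumr -big_split /=; apply: eq_bigr => r _.
rewrite scaler_sumr -big_split /=; apply: eq_bigr => i _.
by rewrite !ffunE linearP.
Qed.

HB.instance Definition _ (h : hom_matrix) :=
  GRing.isLinear.Build R (powsum A m) (powsum B n) *:%R (matrix_map h)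
    (matrix_map_is_linear h).

Definition block_diagonal (h : hom_matrix) (f : forall r, {linear A r -> B r}) :
    Prop :=
  (forall (r : 'I_t) (j : 'I_(n r)) (i : 'I_(m r)),
      h r j r i =1 f r \/ h r j r i =1 \0) /\
  (forall (s r : 'I_t) (j : 'I_(n s)) (i : 'I_(m r)),
      s != r -> h s j r i =1 \0).
End MatrixMap.

Definition hom_class (R : pzRingType) : Type :=
  forall M N : lmodType R, {linear M -> N} -> Prop.

Record is_ideal (R : pzRingType) (I : hom_class R) : Prop := IsIdeal {
  ideal_zero : forall M N : lmodType R, I M N \0;
  ideal_add : forall (M N : lmodType R) (f g : {linear M -> N}),
    I M N f -> I M N g -> I M N (f \+ g);
  ideal_opp : forall (M N : lmodType R) (f : {linear M -> N}),
    I M N f -> I M N (\- f);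
  ideal_comp : forall (L M N P : lmodType R)
      (f : {linear N -> P}) (g : {linear M -> N}) (h : {linear L -> M}),
    I M N g -> I L P (f \o g \o h)
}.

Definition ideal_generated_by (R : pzRingType) (K : Type)
    (M N : K -> lmodType R) (f : forall k, {linear M k -> N k}) : hom_class R :=
  fun U V phi => forall I : hom_class R,
    is_ideal I -> (forall k, I (M k) (N k) (f k)) -> I U V phi.

Lemma ideal_generated_by_least (R : pzRingType) (K : Type)
    (M N : K -> lmodType R) (f : forall k, {linear M k -> N k}) :
  [/\ is_ideal (ideal_generated_by f),
      forall k, ideal_generated_by f (f k)
    & forall I : hom_class R, is_ideal I -> (forall k, I (M k) (N k) (f k)) ->
        forall (U V : lmodType R) (phi : {linear U -> V}),
          ideal_generated_by f phi -> I U V phi].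
Proof.
split; last 2 first.
- by move=> k I _; apply.
- by move=> I idI If U V phi; apply.
split.
- by move=> U V I idI _; apply: ideal_zero.
- by move=> U V g h Ig Ih I idI If; apply: ideal_add; [|apply: Ig|apply: Ih].
- by move=> U V g Ig I idI If; apply: ideal_opp; [|apply: Ig].
- by move=> L U V P g h k Ih I idI If; apply: ideal_comp; [|apply: Ih].
Qed.

(* Main.v *)
Require Import Defs.
From Stdlib Require Import FunctionalExtensionality ProofIrrelevance.
From HB Require Import structures.
From mathcomp Require Import all_boot all_order all_algebra.

(** An ideal contains every map whose matrix entries, for some decomposition of
    its source and target into finite direct sums, all lie in the ideal: such
    a map is the sum, over the positions of the matrix, of an injection after
    the entry after a projection ([matrix_map_in_ideal]).  The entries
    of a block diagonal matrix are some [f k] or zero, so the factorable maps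
    belong to the ideal generated by the [f k].

    Conversely, the finite sums of maps [b \o f k \o a] form an ideal that
    contains every [f k] ([fsum_is_ideal]), hence contains the generated one,
    and such a sum with [t] terms factors through the [t] x [t] diagonal matrix
    with diagonal entries [f (k r)], all multiplicities being 1
    ([fsum_factors]).

    An ideal is a predicate on linear maps as bundled objects, while
    factorizations are pointwise identities; the two meet by functional
    extensionality and proof irrelevance ([linear_ext]). *)

Set Implicit Arguments.
Unset Strict Implicit.
Unset Printing Implicit Defensive.

Import GRing.Theory.
Local Open Scope ring_scope.

Lemma linear_ext (R : pzRingType) (U V : lmodType R) (g h : {linear U -> V}) :
  g =1 h -> g = h.
Proof.
case: g h => [g [[pg] [qg]]] [h [[ph] [qh]]] /= /functional_extensionality gh.
case: _ / gh in ph qh *.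
by rewrite (proof_irrelevance _ ph pg) (proof_irrelevance _ qh qg).
Qed.

(** * Coordinates in direct sums *)

Section Coordinates.
Variables (R : pzRingType) (t : nat) (A : 'I_t -> lmodType R).

(** The [s]-th coordinate of the [r]-th injection into the direct sum of the
    [A r]: the identity when [s = r], zero otherwise.  Going through [dfwith]
    avoids casting along [s = r]. *)
Definition dirac (r s : 'I_t) (x : A r) : A s := dfwith (fun s => 0 : A s) x s.

Fact dirac_is_linear r s : linear (@dirac r s).
Proof.
move=> c x y; rewrite /dirac; case: (eqVneq r s) => [<-|rs].
  by rewrite !dfwith_in.
by rewrite !dfwith_out // scaler0 addr0.
Qed.
HB.instance Definition _ r s :=
  GRing.isLinear.Build R (A r) (A s) *:%R (@dirac r s) (@dirac_is_linear r s).

Lemma dirac_id r x : @dirac r r x = x.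
Proof. exact: dfwith_in. Qed.

Lemma dirac_neq r s x : r != s -> @dirac r s x = 0.
Proof. exact: dfwith_out. Qed.

Lemma sum_dirac (x : forall r, A r) s : \sum_r dirac s (x r) = x s.
Proof.
rewrite (bigD1 s) //= dirac_id big1 ?addr0 // => r.
exact: dirac_neq.
Qed.

Variable m : 'I_t -> nat.

Definition coord r (i : 'I_(m r)) (x : powsum A m) : A r := x r i.

Fact coord_is_linear r i : linear (@coord r i).
Proof. by move=> c x y; rewrite /coord !ffunE. Qed.
HB.instance Definition _ r i :=
  GRing.isLinear.Build R (powsum A m) (A r) *:%R (@coord r i)
    (@coord_is_linear r i).

(* The comparison of i and j takes place in nat, their types differing. *)
Definition inj r (i : 'I_(m r)) (x : A r) : powsum A m :=
  [ffun s => [ffun j : 'I_(m s) => dirac s x *+ (j == i :> nat)]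
    : (A s ^ m s)%type].

Fact inj_is_linear r i : linear (@inj r i).
Proof.
move=> c x y; apply/ffunP=> s; rewrite !ffunE; apply/ffunP=> j.
by rewrite !ffunE linearP mulrnDl scalerMnr.
Qed.
HB.instance Definition _ r i :=
  GRing.isLinear.Build R (A r) (powsum A m) *:%R (@inj r i)
    (@inj_is_linear r i).

Lemma coord_inj r (i : 'I_(m r)) s (j : 'I_(m s)) (x : A r) :
  coord j (inj i x) = dirac s x *+ (j == i :> nat).
Proof. by rewrite /coord !ffunE. Qed.

Lemma powsum_ext (x y : powsum A m) :
  (forall r (i : 'I_(m r)), coord i x = coord i y) -> x = y.
Proof. by move=> xy; apply/ffunP=> r; apply/ffunP=> i; exact: xy. Qed.

Lemma sum_inj (x : powsum A m) :
  \sum_r \sum_(i < m r) inj i (coord i x) = x.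
Proof.
apply: powsum_ext => s j; rewrite linear_sum (bigD1 s) //= [X in _ + X]big1.
  rewrite addr0 linear_sum (bigD1 j) //= coord_inj dirac_id eqxx.
  rewrite big1 ?addr0 // => i ij.
  by rewrite coord_inj val_eqE eq_sym (negPf ij).
move=> r rs; rewrite linear_sum big1 // => i _.
by rewrite /= coord_inj dirac_neq // mul0rn.
Qed.
End Coordinates.

Lemma coord_matrix_map (R : pzRingType) (t : nat) (A B : 'I_t -> lmodType R)
    (m n : 'I_t -> nat) (h : hom_matrix A B m n) x s (j : 'I_(n s)) :
  coord j (matrix_map h x) = \sum_r \sum_(i < m r) h s j r i (coord i x).
Proof. by rewrite /coord !ffunE. Qed.

(** * Maps all of whose matrix entries lie in an ideal *)

Section IdealSums.
Variables (R : pzRingType) (I : hom_class R).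
Hypothesis idI : is_ideal I.

(** Membership for plain functions, so that sums of members can be formed
    without bundling every partial sum as a linear map. *)
Definition in_ideal (U V : lmodType R) (g : U -> V) : Prop :=
  exists2 g' : {linear U -> V}, I g' & g =1 g'.

Lemma in_idealW (U V : lmodType R) (g : {linear U -> V}) : in_ideal g -> I g.
Proof. by case=> g' Ig' /linear_ext ->. Qed.

Lemma in_ideal_sum (U V : lmodType R) (J : finType) (F : J -> U -> V) :
  (forall i, in_ideal (F i)) -> in_ideal (fun x => \sum_i F i x).
Proof.
move=> IF; elim: (index_enum J) => [|i s [g Ig Eg]].
  by exists \0; [exact: ideal_zero | move=> x; rewrite big_nil].
have [g' Ig' Eg'] := IF i.
exists (g' \+ g); first exact: ideal_add.
by move=> x; rewrite big_cons Eg Eg'.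
Qed.

(** Injections and projections expand a matrix map as the sum, over all
    positions, of [inj \o entry \o coord]; each summand is a member because
    its middle factor is. *)
Lemma matrix_map_in_ideal (t : nat) (A B : 'I_t -> lmodType R)
    (m n : 'I_t -> nat) (h : hom_matrix A B m n) :
  (forall s (j : 'I_(n s)) r (i : 'I_(m r)), I (h s j r i)) ->
  I (matrix_map h).
Proof.
move=> Ih; apply: in_idealW.
suff [g Ig Eg] : in_ideal (fun x =>
    \sum_s \sum_(j < n s) \sum_r \sum_(i < m r) inj j (h s j r i (coord i x)) : powsum B n).
  exists g => // x; rewrite -Eg -[LHS]sum_inj.
  apply: eq_bigr => s _; apply: eq_bigr => j _.
  rewrite coord_matrix_map linear_sum; apply: eq_bigr => r _.
  by rewrite linear_sum.
apply: in_ideal_sum => s; apply: in_ideal_sum => j.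
apply: in_ideal_sum => r; apply: in_ideal_sum => i.
by exists (inj j \o h s j r i \o coord i) => //; apply: ideal_comp.
Qed.
End IdealSums.

(** * Factoring a finite sum through a diagonal matrix *)

Section DiagonalFactorization.
Variables (R : pzRingType) (t : nat) (A B : 'I_t -> lmodType R).
Variables (U V : lmodType R) (g : forall r, {linear A r -> B r}).
Variables (a : forall r, {linear U -> A r}) (b : forall r, {linear B r -> V}).

Notation one := (fun _ : 'I_t => 1%N).

Definition tuple_map (x : U) : powsum A one :=
  [ffun r => [ffun _ : 'I_1 => a r x] : (A r ^ 1)%type].

Fact tuple_map_is_linear : linear tuple_map.
Proof.
by move=> c x y; apply: powsum_ext => r i; rewrite /coord !ffunE linearP.
Qed.
HB.instance Definition _ :=
  GRing.isLinear.Build R U (powsum A one) *:%R tuple_map tuple_map_is_linear.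

Definition cotuple_map (y : powsum B one) : V :=
  \sum_r b r (@coord _ _ _ one r ord0 y).

Fact cotuple_map_is_linear : linear cotuple_map.
Proof.
move=> c x y; rewrite /cotuple_map scaler_sumr -big_split.
by apply: eq_bigr => r _; rewrite !linearP.
Qed.
HB.instance Definition _ :=
  GRing.isLinear.Build R (powsum B one) V *:%R cotuple_map cotuple_map_is_linear.

Definition diag : hom_matrix A B one one :=
  fun s _ r _ => @dirac R t B r s \o g r.

Lemma diag_block_diagonal : block_diagonal diag g.
Proof.
split=> [r j i|s r j i sr]; first by left=> x; apply: dirac_id.
by move=> x; apply: dirac_neq; rewrite eq_sym.
Qed.

(** Row [s] of the matrix has [g s] as its only nonzero entry, so the matrix
    turns the tuple of the [a r x] into the tuple of the [g r (a r x)]. *)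
Lemma sum_diag x :
  \sum_r b r (g r (a r x)) = (cotuple_map \o matrix_map diag \o tuple_map) x.
Proof.
apply: eq_bigr => s _; rewrite coord_matrix_map; congr (b s _).
rewrite -[LHS](sum_dirac (fun r => g r (a r x))); apply: eq_bigr => r _.
by rewrite big_ord1 /= /coord !ffunE.
Qed.
End DiagonalFactorization.

(** * The ideal of finite sums of maps that factor through a generator *)

Section FiniteSums.
Variables (R : pzRingType) (K : Type) (M N : K -> lmodType R).
Variable f : forall k, {linear M k -> N k}.

(** The data of a summand [b \o f k \o a]; the objects [M k] and [N k] that it
    passes through vary from one summand to the next. *)
Record fterm (U V : lmodType R) : Type := FTerm {
  term_index : K;
  term_in : {linear U -> M term_index};
  term_out : {linear N term_index -> V}
}.

Definition fterm_map (U V : lmodType R) (c : fterm U V) (x : U) : V :=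
  term_out c (f (term_index c) (term_in c x)).

Definition fsum : hom_class R := fun U V phi =>
  exists s : seq (fterm U V), phi =1 fun x => \sum_(c <- s) fterm_map c x.

(** Sums add by concatenation; a sign or an outer factor on the left goes into
    each [b], a factor on the right into each [a]. *)
Lemma fsum_is_ideal : is_ideal fsum.
Proof.
split.
- by move=> U V; exists [::] => x; rewrite big_nil.
- move=> U V g h [s Eg] [s' Eh]; exists (s ++ s') => x.
  by rewrite big_cat /= Eg Eh.
- move=> U V g [s Eg].
  pose opp (c : fterm U V) : fterm U V :=
    FTerm (term_in c) (\- term_out c).
  exists (map opp s) => x; rewrite big_map /= Eg.
  by rewrite -sumrN.
- move=> U U' V' V p g q [s Eg].
  pose comp (c : fterm U' V') : fterm U V :=
    FTerm (term_in c \o q) (p \o term_out c).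
  exists (map comp s) => x; rewrite big_map /= Eg.
  by rewrite linear_sum.
Qed.

Lemma fsum_generator k : fsum (f k).
Proof.
by exists [:: @FTerm _ _ k idfun idfun] => x; rewrite big_cons big_nil addr0.
Qed.

Lemma fsum_factors (U V : lmodType R) (phi : {linear U -> V}) : fsum phi ->
  exists (t : nat) (k : 'I_t -> K)
         (h : hom_matrix (fun r => M (k r)) (fun r => N (k r))
                (fun=> 1%N) (fun=> 1%N))
         (a : {linear U -> powsum (fun r => M (k r)) (fun=> 1%N)})
         (b : {linear powsum (fun r => N (k r)) (fun=> 1%N) -> V}),
    block_diagonal h (fun r => f (k r)) /\ phi =1 b \o matrix_map h \o a.
Proof.
case=> s Ephi; pose c r := tnth (in_tuple s) r.
exists (size s), (fun r => term_index (c r)), (diag (fun r => f (term_index (c r)))).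
exists (tuple_map (fun r => term_in (c r))).
exists (cotuple_map (fun r => term_out (c r))).
split; first exact: diag_block_diagonal.
by move=> x; rewrite Ephi big_tnth -sum_diag.
Qed.
End FiniteSums.

Theorem mainTheorem7 (R : pzRingType) (K : Type) (M N : K -> lmodType R)
    (f : forall k : K, {linear M k -> N k})
    (U V : lmodType R) (phi : {linear U -> V}) :
  ideal_generated_by f phi <->
  exists (t : nat) (k : 'I_t -> K) (m n : 'I_t -> nat)
         (h : hom_matrix (fun r => M (k r)) (fun r => N (k r)) m n)
         (a : {linear U -> powsum (fun r => M (k r)) m})
         (b : {linear powsum (fun r => N (k r)) n -> V}),
    [/\ forall r : 'I_t, (0 < m r)%N,
        forall r : 'I_t, (0 < n r)%N,
        block_diagonal h (fun r => f (k r))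
      & phi =1 b \o matrix_map h \o a].
Proof.
split.
  move=> /(_ (fsum f) (fsum_is_ideal f) (fsum_generator f)) /fsum_factors.
  case=> t [k [h [a [b [hdiag Ephi]]]]].
  by exists t, k, (fun=> 1%N), (fun=> 1%N), h, a, b.
case=> t [k [m [n [h [a [b [_ _ [hdiag hoff] Ephi]]]]]]] I idI If.
rewrite (linear_ext (h := b \o matrix_map h \o a) Ephi).
apply: ideal_comp => //; apply: matrix_map_in_ideal => // s j r i.
have [sr|/hoff sr] := eqVneq s r; last first.
  by rewrite (linear_ext (sr j i)); apply: ideal_zero.
case: r / sr i => i.
by have [] := hdiag s j i => /linear_ext ->; [apply: If | apply: ideal_zero].
Qed.
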